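(* For every $\varepsilon>0$ there is an integer $p_\varepsilon\ge 5$ such that, for every prime $p\ge p_\varepsilon$, there is a set $A\subseteq\mathbb Z/p\mathbb Z$, with $|A|\ge 2$ and no unique sum, for which $$|A|\le \frac{(\log p)^2}{2(\log 3)^2}+\left(\frac{2}{\log 3}+\varepsilon\right)\frac{(\log p)^2}{\log\log p}.$$ Consequently, as $p\to\infty$ through the primes, $$m(p)\le \frac{(\log p)^2}{2(\log 3)^2}+\left(\frac{2}{\log 3}+o(1)\right)\frac{(\log p)^2}{\log\log p}.$$ In particular, $$m(p)\le\left(\frac{1}{2(\log_2 3)^2}+o(1)\right)(\log_2 p)^2,$$ where $\frac{1}{2(\log_2 3)^2}=0.199036176970870\ldots$.
   Context: $\log$ is the natural logarithm and $\log_2$ the base-two logarithm. For an abelian group $G$, a set $A\subseteq G$ has no unique sum if for all $a,b\in A$ there are $c,d\in A$ with $a+b=c+d$ and not ($(a=c$ and $b=d)$ or $(a=d$ and $b=c)$); i.e. no element of $A+A$ has exactly one representation as the sum of an unordered pair (two-element multiset, repetition allowed) of elements of $A$. For a prime $p\ge3$, $m(p)$ is the minimum of $|A|$ over all $A\subseteq\mathbb Z/p\mathbb Z$ with $|A|\ge2$ having no unique sum (this minimum exists). *)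

(* Defs.v *)
From mathcomp Require Import all_boot all_order all_algebra.
From mathcomp Require Import all_classical all_reals all_analysis.

Set Implicit Arguments.
Unset Strict Implicit.
Unset Printing Implicit Defensive.

Import Order.TTheory GRing.Theory Num.Theory.

Local Open Scope ring_scope.

Definition no_unique_sum (G : finZmodType) (A : {set G}) : bool :=
  [forall a in A, forall b in A, exists c in A, exists d in A,
     (a + b == c + d)
     && ~~ ((a == c) && (b == d) || (a == d) && (b == c))].

(* The default value [set: 'Z_p] of the minimization is itself a candidate
   when p >= 3 is prime, see min_no_unique_sumP; the value is meaningless for
   other p. *)
Definition min_no_unique_sum (p : nat) : nat :=
  #|[arg min_(A < [set: 'Z_p]%SET | (2 <= #|A|) && no_unique_sum A) #|A|]|%N.

Lemma no_unique_sum_setT (p : nat) :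
  prime p -> (3 <= p)%N -> no_unique_sum [set: 'Z_p]%SET.
Proof.
move=> pp p3; apply/forall_inP => a _; apply/forall_inP => b _.
have cZ : #|'Z_p| = p by rewrite card_ord Zp_cast ?prime_gt1.
have : (0 < #|~: [set 0%R; (b - a)%R]%SET|)%N.
  rewrite -(ltn_add2l #|[set 0%R; (b - a)%R]%SET|) addn0 cardsC cZ cards2.
  by case: (_ != _); rewrite // ltnW.
case/card_gt0P => t; rewrite !inE negb_or => /andP[t0 tba].
apply/exists_inP; exists (a + t); rewrite ?inE //.
apply/exists_inP; exists (b - t); rewrite ?inE //.
rewrite addrACA subrr addr0 eqxx /= negb_or !negb_and.
rewrite -{1}[a]addr0 (inj_eq (addrI a)) [0 == t]eq_sym t0 /=.
by apply/orP; right; apply: contra tba => /eqP ->; rewrite addrAC subrr add0r.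
Qed.

Lemma min_no_unique_sumP (p : nat) : prime p -> (3 <= p)%N ->
  (exists A : {set 'Z_p},
     [/\ (2 <= #|A|)%N, no_unique_sum A & #|A| = min_no_unique_sum p]) /\
  (forall A : {set 'Z_p}, (2 <= #|A|)%N -> no_unique_sum A ->
     (min_no_unique_sum p <= #|A|)%N).
Proof.
move=> pp p3; rewrite /min_no_unique_sum; case: arg_minnP.
  rewrite no_unique_sum_setT // andbT cardsT card_ord Zp_cast ?prime_gt1 //.
move=> A /andP[A2 uA] minA; split; first by exists A.
by move=> B B2 uB; apply: minA; rewrite B2.
Qed.

Definition log2 (R : realType) (x : R) : R := ln x / ln 2.

(* [:: d1; d2; ...; dn] encodes the decimal number 0.d1d2...dn. *)
Definition decimal (R : realType) (s : seq nat) : R :=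
  \sum_(i < size s) (nth 0%N s i)%:R / 10 ^+ i.+1.

(* Main.v *)
Require Import Defs.
From mathcomp Require Import all_boot all_order all_algebra zify ring lra.
From mathcomp Require Import all_classical all_reals all_analysis.
Import Order.TTheory GRing.Theory Num.Theory.
Import numFieldNormedType.Exports.
Local Open Scope classical_set_scope.
Local Open Scope ring_scope.

(** If every element of a set [S] is the average of three elements of [S] that
are not all equal to it, then [S + S] has no unique sum, and it has at most
[s * (s + 1) / 2] elements, [s = #|S|]. So a set [S] of
[log_3 p + O(log p / log log p)] elements of this kind is wanted. The powers
[3 ^ j], [j < n], with [3 ^ n >= p], and [0] satisfy
[3 * 3 ^ j = 3 ^ (j + 1) + 0 + 0], so that only [0 = 0 + 1 + (-1)] and the last
power are missing: it suffices to adjoin [-1] and [3 ^ n]. A set may be enlarged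
freely by averages of three of its elements. To reach a residue [a], write
[a * 3 ^ e] in base [3 ^ k]; collecting equal digits in ternary averaging trees
costs half the number [n / k] of digits, up to lower order terms when [3 ^ k] is
about [n ^ (2/3)]. *)

(** * Sumsets without unique sums *)

Definition nontrivial_average {G : zmodType} (S : {pred G}) (x : G) : Prop :=
  exists a b c, [/\ a \in S, b \in S, c \in S, x *+ 3 = a + b + c
                  & ~~ [&& a == x, b == x & c == x]].

Lemma nontrivial_averageS {G : zmodType} {S T : {pred G}} {x} :
  {subset S <= T} -> nontrivial_average S x -> nontrivial_average T x.
Proof.
move=> sST [a [b [c [aS bS cS e ne]]]].
by exists a, b, c; split=> //; exact: sST.
Qed.

Lemma no_unique_sum_sumset {G : finZmodType} (S : {set G}) :
  (forall x : G, x *+ 2 = 0 -> x = 0) -> (forall x : G, x *+ 3 = 0 -> x = 0) ->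
  (forall x, x \in S -> nontrivial_average S x) ->
  no_unique_sum [set x + y | x in S, y in S]%SET.
Proof.
move=> tf2 tf3 avgS.
pose A := [set x + y | x in S, y in S]%SET.
have AP x y : x \in S -> y \in S -> x + y \in A by move=> xS yS; apply: imset2_f.
have tf n (x : G) : (0 < n < 4)%N -> x *+ n = 0 -> x = 0.
  by case: n => [|[|[|[|n]]]] // _; [exact: tf2 | exact: tf3].
apply/forall_inP => _ /imset2P[s t sS tS ->].
apply/forall_inP => _ /imset2P[u v uS vS ->].
suff [c [d [cA dA e ne]]] : exists c d, [/\ c \in A, d \in A,
    s + t + (u + v) = c + d & ~~ ((s + t == c) && (u + v == d)
      || (s + t == d) && (u + v == c))].
  apply/exists_inP; exists c => //; apply/exists_inP; exists d => //.
  by rewrite e eqxx.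
(* Exchanging summands between [s + t] and [u + v] fails only if three of the
   four are equal to some [z]; then [z + z + z] is replaced by [a + b + c]. *)
have triple w z : w \in S -> z \in S -> exists c d, [/\ c \in A, d \in A,
    w + z + (z + z) = c + d & ~~ ((w + z == c) && (z + z == d)
      || (w + z == d) && (z + z == c))].
  move=> wS zS; have [a [b [c [aS bS cS e ne]]]] := avgS z zS.
  have sumE : w + z + (z + z) = w + z *+ 3 by rewrite !mulrS mulr0n addr0 !addrA.
  have good a' b' c' : a' \in S -> b' \in S -> c' \in S ->
      a' + b' + c' = z *+ 3 -> a' != z -> w + a' != z + z ->
      exists c d, [/\ c \in A, d \in A, w + z + (z + z) = c + d
        & ~~ ((w + z == c) && (z + z == d) || (w + z == d) && (z + z == c))].
    move=> aS' bS' cS' e' ne1 ne2; exists (w + a'), (b' + c').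
    split; [exact: AP | exact: AP | by rewrite sumE -e' !addrA |].
    rewrite (inj_eq (addrI w)) eq_sym (negPf ne1) /= negb_and orbC eq_sym.
    by rewrite (negPf ne2).
  have [aB|/norP[]] := boolP ((a == z) || (w + a == z + z)); last first.
    by apply: (good a b c); rewrite ?e.
  have [bB|/norP[]] := boolP ((b == z) || (w + b == z + z)); last first.
    by apply: (good b a c) => //; rewrite [RHS]e [b + a]addrC.
  have [cB|/norP[]] := boolP ((c == z) || (w + c == z + z)); last first.
    by apply: (good c a b) => //; rewrite [RHS]e -addrA addrC.
  (* In the remaining case each of [a], [b], [c] is [z] or [z + (z - w)]. Comparing their sum with
     [z *+ 3] gives [(z - w) *+ (i + j + k) = 0] with at most three copies; the torsion hypotheses
     then force [a], [b], [c] all to be [z]. *)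
  have shift x : (x == z) || (w + x == z + z) ->
      exists i : bool, x = z + (z - w) *+ i.
    case/orP=> [/eqP->|/eqP xE]; first by exists false; rewrite addr0.
    by exists true; rewrite mulr1n addrA -xE addrC addKr.
  have [i aE] := shift a aB; have [j bE] := shift b bB.
  have [k cE] := shift c cB.
  have : (z - w) *+ (i + j + k) = 0.
    apply: (addrI (z *+ 3)); rewrite addr0 {2}e aE bE cE !mulrnDr.
    by rewrite !mulrS mulr0n addr0 [z + _ + (z + _)]addrACA [RHS]addrACA !addrA.
  have [/eqP|ijk_gt0] := posnP (i + j + k)%N.
    move: ne; rewrite aE bE cE; case: i j k {aE bE cE} => [] [] [] //=.
    by rewrite addr0 eqxx.
  move/tf => zw; move: ne; rewrite aE bE cE zw ?mul0rn ?addr0 ?eqxx //=.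
  by rewrite ijk_gt0; case: i j k {aE bE cE ijk_gt0 zw} => [] [] [].
have [tusv|/norP[tu sv]] := boolP ((t == u) || (s == v)); last first.
  exists (s + u), (t + v); split; [exact: AP|exact: AP|exact: addrACA|].
  rewrite (inj_eq (addrI s)) (negPf tu) /= negb_and [t + v]addrC.
  by rewrite (inj_eq (addIr t)) sv.
have [tvsu|/norP[tv su]] := boolP ((t == v) || (s == u)); last first.
  exists (s + v), (t + u); split; [exact: AP|exact: AP| |].
    by rewrite [u + v]addrC addrACA.
  rewrite (inj_eq (addrI s)) (negPf tv) /= negb_and [t + u]addrC.
  by rewrite (inj_eq (addIr t)) su.
have swapped w z : w \in S -> z \in S -> exists c d, [/\ c \in A, d \in A,
    z + z + (z + w) = c + d & ~~ ((z + z == c) && (z + w == d)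
      || (z + z == d) && (z + w == c))].
  move=> wS zS; have [c [d [cA dA e ne]]] := triple w z wS zS.
  exists d, c; split=> //; first by rewrite [RHS]addrC -e [RHS]addrC [z + w]addrC.
  by rewrite [z + w]addrC andbC [X in _ || X]andbC.
case/orP: tusv => /eqP tusv; case/orP: tvsu => /eqP tvsu; subst.
- exact: triple.
- exact: swapped.
- by rewrite [u + v]addrC; apply: swapped.
- by rewrite [u + t]addrC; apply: triple.
Qed.

(** * Enlarging a set by averages of three elements *)

(** Only new elements need an average: extensions then compose, their costs [c] adding up, and the
    elements of the initial set are treated once, at the end. *)
Definition average_extension {G : finZmodType} (S T : {set G}) (c : nat) :=
  [/\ S \subset T, (#|T| <= #|S| + c)%N
    & forall x, x \in T -> x \notin S -> nontrivial_average T x].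

Section AverageExtension.
Variable F : finComUnitRingType.
Hypothesis unit3 : (3 : F) \is a GRing.unit.
Implicit Types (S T U : {set F}) (s : seq F).

Lemma average_extension_refl S c : average_extension S S c.
Proof. by split=> // [|x ->//]; rewrite leq_addr. Qed.

Lemma average_extension_sub S T c :
  average_extension S T c -> {subset S <= T}.
Proof. by case=> /fintype.subsetP. Qed.

Lemma average_extension_trans S T U c d :
  average_extension S T c -> average_extension T U d ->
  average_extension S U (c + d).
Proof.
move=> [sST cT avT] [sTU cU avU]; split; first exact: fintype.subset_trans sTU.
  by apply: (leq_trans cU); rewrite addnA leq_add2r.
move=> x xU xS; have [xT|] := boolP (x \in T); last exact: avU.
exact: nontrivial_averageS (fintype.subsetP sTU) (avT x xT xS).
Qed.

(** A new average is never trivial, since it lies outside [S] while [a] lies in [S]. An average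
    already present costs nothing. *)
Lemma average_extension1 S a b c : a \in S -> b \in S -> c \in S ->
  exists T, average_extension S T 1 /\ (a + b + c) / 3 \in T.
Proof.
move=> aS bS cS; set x := _ / 3.
have [xS|xS] := boolP (x \in S).
  by exists S; split => //; exact: average_extension_refl.
exists (x |: S)%SET; split; last by rewrite finset.setU11.
split; first exact: finset.subsetUr.
  by rewrite cardsU1 addnC leq_add2l leq_b1.
move=> y; rewrite !inE => /orP[/eqP->|->//] _; exists a, b, c.
split; rewrite ?inE ?aS ?bS ?cS ?orbT //.
  by rewrite -mulr_natr divrK.
by apply: contra xS => /and3P[/eqP <-].
Qed.

(** The sequence is cut into triples, each replaced by its average; [0] pads an incomplete last
    triple. *)
Lemma average_extension_step S s : 0 \in S -> all (mem S) s ->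
  exists (T : {set F}) (t : seq F),
    [/\ average_extension S T (size t), all (mem T) t,
    \sum_(x <- t) x = (\sum_(x <- s) x) / 3 & (3 * size t <= size s + 2)%N].
Proof.
move=> S0; have [n] := ubnP (size s); elim: n s => // n IHn.
have one a b c (s : seq F) : a \in S -> b \in S -> c \in S -> all (mem S) s ->
  (size s < n)%N ->
  exists (T : {set F}) (t : seq F),
    [/\ average_extension S T (size t), all (mem T) t,
    \sum_(x <- t) x = (\sum_(x <- [:: a, b, c & s]) x) / 3
    & (3 * size t <= size s + 5)%N].
  move=> aS bS cS sS sn; have [T [t [eT tT tE tn]]] := IHn s sn sS.
  have sT := average_extension_sub _ _ _ eT.
  have [U [eU xU]] := average_extension1 _ _ _ _ (sT _ aS) (sT _ bS) (sT _ cS).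
  exists U, ((a + b + c) / 3 :: t); split.
  - by rewrite /= -addn1; exact: average_extension_trans eT eU.
  - rewrite /= xU; apply/allP => x /(allP tT).
    exact: average_extension_sub _ _ _ eU x.
  - by rewrite !big_cons tE -mulrDl !addrA.
  - by rewrite /= mulnS addnC -[5%N]/(2 + 3)%N addnA leq_add2r.
have pad a b : (0 < n)%N -> a \in S -> b \in S ->
  exists (T : {set F}) (t : seq F),
    [/\ average_extension S T (size t), all (mem T) t,
    \sum_(x <- t) x = (a + b) / 3 & (3 * size t <= 3)%N].
  move=> n0 aS bS; have [//||T [t [eT tT tE tn]]] := one a b 0 [::] aS bS S0 => //.
  exists T, t; split => //; first by rewrite tE !big_cons big_nil !addr0.
  by move: tn => /=; lia.
case=> [|a [|b [|c s]]] /=.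
- move=> _ _; exists S, [::]; split=> //; first exact: average_extension_refl.
  by rewrite !big_nil mul0r.
- rewrite ltnS andbT => n0 aS; have [T [t [eT tT tE tn]]] := pad _ _ n0 aS S0.
  by exists T, t; split; rewrite ?tE ?big_cons ?big_nil.
- rewrite ltnS andbT => n0 /andP[aS bS].
  have [|T [t [eT tT tE tn]]] := pad a b _ aS bS; first exact: leq_trans n0.
  by exists T, t; split; rewrite ?tE ?big_cons ?big_nil ?addr0 // (leq_trans tn).
- rewrite ltnS => sn /and4P[aS bS cS sS].
  have [|T [t [eT tT tE tn]]] := one a b c s aS bS cS sS.
    by apply: leq_trans sn; rewrite ltnS -addn2 leq_addr.
  by exists T, t; split=> //; apply: leq_trans tn _; rewrite -[5%N]/(3 + 2)%N addnA addn3.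
Qed.

(** The levels cost [n / 3 + n / 9 + ...], at most [n / 2], and rounding up is paid for by one
    element per level. All [L] levels are performed even on a short sequence, so that several
    sequences share the divisor [3 ^+ L]. *)
Lemma average_extension_tree L S s : 0 \in S -> all (mem S) s ->
  (size s <= 3 ^ L)%N ->
  exists T c, [/\ average_extension S T c, (2 * c <= size s + 2 * L)%N
    & (\sum_(x <- s) x) / 3 ^+ L \in T].
Proof.
elim: L S s => [|L IHL] S s S0 sS sn.
  exists S, 0%N; split=> //; first exact: average_extension_refl.
  rewrite divr1; case: s sS sn => [|x [|]] //=; rewrite ?big_nil ?big_cons ?big_nil //.
  by rewrite addr0 andbT.
have [T [t [eT tT tE tn]]] := average_extension_step S s S0 sS.
have T0 := average_extension_sub _ _ _ eT 0 S0.
have [|U [c [eU c2 xU]]] := IHL T t T0 tT.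
  by rewrite expnS in sn; lia.
exists U, (size t + c)%N; split; first exact: average_extension_trans eT eU.
  by lia.
by move: xU; rewrite tE exprS invrM ?unitrX // mulrAC mulrA mulrAC.
Qed.

Lemma average_extension_trees L S (ss : seq (seq F)) : 0 \in S ->
  {in ss, forall s, all (mem S) s} ->
  {in ss, forall s, (size s <= 3 ^ L)%N} ->
  exists T c, [/\ average_extension S T c,
    (2 * c <= size (flatten ss) + 2 * L * size ss)%N
    & {in ss, forall s, (\sum_(x <- s) x) / 3 ^+ L \in T}].
Proof.
elim: ss S => [|s ss IHs] S S0 ssS ssn.
  by exists S, 0%N; split=> //; exact: average_extension_refl.
have [|||T [c [eT c2 xT]]] := average_extension_tree L S s => //.
- by apply: ssS; rewrite mem_head.
- by apply: ssn; rewrite mem_head.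
have sT := average_extension_sub _ _ _ eT.
have [|||U [d [eU d2 xU]]] := IHs T.
- exact: sT.
- move=> t tss; apply/allP => x xt; apply: sT.
  by apply: (allP (ssS t _)); rewrite ?in_cons ?tss ?orbT.
- by move=> t tss; apply: ssn; rewrite in_cons tss orbT.
exists U, (c + d)%N; split; first exact: average_extension_trans eT eU.
  by rewrite /= size_cat; lia.
move=> t; rewrite in_cons => /orP[/eqP->|]; last exact: xU.
exact: average_extension_sub _ _ _ eU _ xT.
Qed.

(** Horner's rule for division by [3]: each step averages the value reached, the next [V l] and
    [0]. *)
Lemma average_extension_horner k S (V : nat -> F) : 0 \in S ->
  (forall l, (l < k)%N -> V l \in S) ->
  exists T, average_extension S T k /\
    (\sum_(l < k) V l * 3 ^+ l) / 3 ^+ k \in T.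
Proof.
move=> S0; elim: k => [|k IHk] VS.
  exists S; split; first exact: average_extension_refl.
  by rewrite big_ord0 mul0r.
have [l lk|T [eT xT]] := IHk; first by rewrite VS // ltnW.
have sT := average_extension_sub _ _ _ eT.
have [U [eU xU]] := average_extension1 _ _ _ _ xT (sT _ (VS k (ltnSn k))) (sT _ S0).
exists U; split; first by rewrite -addn1; exact: average_extension_trans eT eU.
move: xU; rewrite big_ord_recr /= addr0.
suff -> : (\sum_(l < k) V l * 3 ^+ l + V k * 3 ^+ k) / 3 ^+ k.+1 =
  ((\sum_(l < k) V l * 3 ^+ l) / 3 ^+ k + V k) / 3 by [].
by rewrite exprS invrM ?unitrX // mulrA mulrDl mulrK ?unitrX.
Qed.
End AverageExtension.

(** * Reaching a residue through its digits *)

Lemma digit_expansion q m N : (0 < q)%N -> (N < q ^ m)%N ->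
  N = (\sum_(i < m) (N %/ q ^ i %% q) * q ^ i)%N.
Proof.
move=> q0 Nq; suff E n : (N %% q ^ n = \sum_(i < n) (N %/ q ^ i %% q) * q ^ i)%N.
  by rewrite -E modn_small.
elim: n => [|n IHn]; first by rewrite big_ord0 modn1.
rewrite big_ord_recr /= -IHn expnSr addnC.
have {1}-> : N = ((N %/ q ^ n %/ q) * (q ^ n * q)
    + (N %/ q ^ n %% q * q ^ n + N %% q ^ n))%N.
  by rewrite addnA [(q ^ n * q)%N]mulnC mulnA -mulnDl -divn_eq -divn_eq.
rewrite modnMDl modn_small //.
have lt1 : (N %/ q ^ n %% q < q)%N by rewrite ltn_mod.
have lt2 : (N %% q ^ n < q ^ n)%N by rewrite ltn_mod expn_gt0 q0.
apply: (@leq_trans ((N %/ q ^ n %% q).+1 * q ^ n)); last first.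
  by rewrite mulnC leq_mul2l lt1 orbT.
by rewrite mulSn addnC ltn_add2r.
Qed.

(** The terms of [2 * c] are: [m + 2 * L * 3 ^ k] for one tree of depth [L] per digit value;
    [2 * k * 3 ^ k + 2 * k * k.+1] for [k] trees of depth [k.+1], enough for [2 * 3 ^ k] leaves;
    [2 * k] for Horner's rule. The exponent of the divisor adds the three depths. *)
Lemma average_extension_quotient (F : finComUnitRingType) k m L (S : {set F}) N :
  (3 : F) \is a GRing.unit -> 0 \in S ->
  (forall i, (i < m)%N -> 3 ^+ (k * i) \in S) ->
  (N < 3 ^ (k * m))%N -> (m <= 3 ^ L)%N ->
  exists T c, [/\ average_extension S T c,
    (2 * c <= m + 2 * L * 3 ^ k + 2 * k * 3 ^ k + 2 * k * k.+2)%N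
    & N%:R / 3 ^+ (L + k.+1 + k) \in T].
Proof.
move=> u3 S0 powS Nlt mL.
(* [D i] is the i-th base [3 ^ k] digit of [N], [t d] is the scaled sum of the
   powers carrying the digit [d], and [digits l] lists each [t d] as often as
   the l-th ternary digit of [d] says, so that [N] is recovered from the sums of
   [digits l] by Horner's rule. *)
pose D i := (N %/ (3 ^ k) ^ i %% 3 ^ k)%N.
have q0 : (0 < 3 ^ k)%N by rewrite expn_gt0.
have Dlt i : (D i < 3 ^ k)%N by rewrite ltn_mod.
pose powers d := [seq (3 : F) ^+ (k * i) | i <- iota 0 m & D i == d].
have [||T [c [eT c2 TE]]] := @average_extension_trees F u3 L S
  [seq powers d | d <- iota 0 (3 ^ k)] S0.
- move=> _ /mapP[d _ ->]; apply/allP => _ /mapP[i im ->]; move: im.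
  by rewrite mem_filter mem_iota => /andP[_ /andP[_]]; exact: powS.
- move=> _ /mapP[d _ ->]; rewrite size_map size_filter.
  by apply: leq_trans (count_size _ _) _; rewrite size_iota.
have sT := average_extension_sub _ _ _ _ eT.
pose t d := (\sum_(x <- powers d) x) / 3 ^+ L.
have tT d : (d < 3 ^ k)%N -> t d \in T.
  by move=> dk; apply: TE; apply: map_f; rewrite mem_iota.
(* Each [i < m] occurs in exactly one list, that of its digit [D i]. *)
have powers_size : size (flatten [seq powers d | d <- iota 0 (3 ^ k)]) = m.
  rewrite size_flatten /shape -map_comp sumnE big_map.
  under eq_bigr do rewrite /= size_map size_filter -sum1_count big_mkcond.
  rewrite exchange_big /= -[RHS](size_iota 0) -sum1_size; apply: eq_bigr => i _.
  rewrite -big_mkcond /= sum1_count (eq_count (a2 := pred1 (D i))).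
    by rewrite count_uniq_mem ?iota_uniq // mem_iota Dlt.
  by move=> d; rewrite /= eq_sym.
pose digits l := flatten
  [seq nseq (d %/ 3 ^ l %% 3) (t d) | d <- iota 0 (3 ^ k)].
have digits_size l : (size (digits l) <= 2 * 3 ^ k)%N.
  rewrite size_flatten /shape -map_comp sumnE big_map -[X in (_ <= 2 * X)%N](size_iota 0).
  rewrite -sum1_size big_distrr /=; apply: leq_sum => d _.
  by rewrite size_nseq -ltnS ltn_mod.
have [|||U [c' [eU c'2 UE]]] := @average_extension_trees F u3 k.+1 T
  [seq digits l | l <- iota 0 k].
- exact: sT.
- move=> _ /mapP[l _ ->]; apply/allP => x /flattenP[_ /mapP[d dk ->]].
  by move=> /nseqP[-> _]; apply: tT; rewrite mem_iota in dk.
- move=> _ /mapP[l _ ->]; apply: leq_trans (digits_size l) _.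
  by rewrite expnS leq_mul2r orbT.
have sU := average_extension_sub _ _ _ _ eU.
have [||W [eW WE]] := @average_extension_horner F u3 k U
  (fun l => (\sum_(x <- digits l) x) / 3 ^+ k.+1).
- by apply/sU/sT.
- by move=> l lk; apply/UE/map_f; rewrite mem_iota.
exists W, (c + (c' + k))%N; split.
- exact: average_extension_trans eT (average_extension_trans _ _ _ _ _ _ eU eW).
- rewrite size_map size_iota powers_size in c2; rewrite size_map size_iota in c'2.
  have : (size (flatten [seq digits l | l <- iota 0 k]) <= k * (2 * 3 ^ k))%N.
    rewrite size_flatten /shape -map_comp sumnE big_map -[X in (_ <= X * _)%N](size_iota 0).
    by rewrite -sum1_size big_distrl /=; apply: leq_sum => l _; rewrite mul1n.
  move: c2 c'2; set X := size _; set Y := (3 ^ k)%N; nia.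
move: WE; congr (_ \in W).
have tE d : t d * 3 ^+ L = \sum_(i < m | D i == d) 3 ^+ (k * i).
  by rewrite /t divrK ?unitrX // big_map big_filter -{1}(subn0 m) big_mkord.
have digitsE l : \sum_(x <- digits l) x =
    \sum_(d < 3 ^ k) t d *+ (d %/ 3 ^ l %% 3).
  rewrite big_flatten big_map -{1}(subn0 (3 ^ k)%N) big_mkord /=.
  by apply: eq_bigr => d _; rewrite big_nseq iter_addr addr0.
under eq_bigr do rewrite mulrAC digitsE.
rewrite -big_distrl /=.
set A := \sum_(l < k) _.
(* After exchanging sums, the ternary digits of each [d] reassemble [d]; then summing over the [i]
   with [D i = d] reassembles [N]. *)
suff -> : N%:R = A * 3 ^+ L.
  rewrite -addnA exprD [in RHS]invrM ?unitrX // [_^-1 * _^-1]mulrC mulrA mulrK ?unitrX //.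
  by rewrite -mulrA -invrM ?unitrX // -exprD addnC.
rewrite /A; under eq_bigr => l do rewrite big_distrl /=.
rewrite exchange_big /= big_distrl /=.
transitivity (\sum_(d < 3 ^ k) t d * 3 ^+ L * d%:R); last first.
  apply: eq_bigr => d _; rewrite mulrAC; congr (_ * _).
  rewrite [X in _ * X%:R](digit_expansion 3 _ _ isT (ltn_ord d)) natr_sum big_distrr /=.
  by apply: eq_bigr => l _; rewrite natrM natrX mulrA mulr_natr.
under eq_bigr do rewrite tE big_distrl /=.
rewrite expnM in Nlt; rewrite [X in X%:R = _](digit_expansion _ _ _ q0 Nlt) natr_sum.
rewrite [RHS](exchange_big_dep predT) //=; apply: eq_bigr => i _.
rewrite (big_pred1 (Ordinal (Dlt i))) /=; last first.
  by move=> d; rewrite /= -(inj_eq val_inj) /= eq_sym.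
by rewrite natrM mulrC !natrX -exprM.
Qed.

(** * Counting sums, and the construction modulo [p] *)

(** Removing [x] from [S] loses only sums in the translate [x + S], which has [#|S|] elements; these
    losses add up to [1 + 2 + ... + #|S|]. *)
Lemma card_sumset {G : finZmodType} (S : {set G}) :
  (2 * #|[set (x + y)%R | x in S, y in S]%SET| <= #|S| * #|S|.+1)%N.
Proof.
have [n] := ubnP #|S|; elim: n S => // n IHn S.
have [->|[x xS]] := set_0Vmem S.
  by move=> _; rewrite (_ : [set _ | _ in _, _ in _]%SET = finset.set0) ?cards0 //;
     apply/setP => z; rewrite inE; apply/imset2P => -[y t]; rewrite inE.
rewrite (cardsD1 x S) xS add1n !ltnS => Sn.
pose T := (S :\ x)%SET.
have sub : ([set y + z | y in S, z in S]
    \subset [set y + z | y in T, z in T] :|: [set x + y | y in S])%SET.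
  apply/fintype.subsetP => _ /imset2P[y z yS zS ->]; rewrite finset.inE.
  have [->|yx] := eqVneq y x; first by apply/orP; right; exact: imset_f.
  have [->|zx] := eqVneq z x.
    by apply/orP; right; rewrite addrC; exact: imset_f.
  by rewrite imset2_f // !finset.inE ?yx ?zx.
have := subset_leq_card sub; rewrite -(leq_pmul2l (ltn0Sn 1)) => /leq_trans; apply.
have IH := IHn T Sn.
have cI : (#|[set (x + y)%R | y in S]%SET| <= #|T|.+1)%N.
  by rewrite (leq_trans (leq_imset_card _ _)) // (cardsD1 x S) xS.
apply: leq_trans (_ : 2 * (#|[set (y + z)%R | y in T, z in T]%SET| + #|T|.+1) <= _)%N.
  rewrite leq_mul2l /=; apply: leq_trans (leq_card_setU _ _) _.
  by rewrite leq_add2l.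
by rewrite mulnDr (leq_trans (leq_add IH (leqnn _))) // -mulnDl mulnC addn2.
Qed.

(** In [s], the part [1 + k * m] counts [0] and the powers of [3]. The bracket is twice the cost of
    reaching one residue, and two are adjoined: [-1] and [3 ^+ (k * m)]. *)
Lemma small_no_unique_sum p k m L : prime p -> (3 < p)%N ->
  (p <= 3 ^ (k * m))%N -> (m <= 3 ^ L)%N ->
  exists A : {set 'Z_p}, [/\ (2 <= #|A|)%N, no_unique_sum A &
    let s := (1 + k * m + (m + 2 * L * 3 ^ k + 2 * k * 3 ^ k + 2 * k * k.+2))%N
    in (2 * #|A| <= s * s.+1)%N].
Proof.
move=> pp p3 pkm mL.
have p1 : (1 < p)%N by exact: prime_gt1.
have unit_small n : (0 < n < p)%N -> (n%:R : 'Z_p) \is a GRing.unit.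
  move=> /andP[n0 np]; rewrite unitZpE // prime_coprime //.
  by apply/negP => /(dvdn_leq n0); rewrite leqNgt np.
have u2 : (2 : 'Z_p) \is a GRing.unit by rewrite unit_small //= (ltnW p3).
have u3 : (3 : 'Z_p) \is a GRing.unit by rewrite unit_small.
pose S := (0 |: [set (3 : 'Z_p) ^+ j | j : 'I_(k * m)])%SET.
have cardS : (#|S| <= 1 + k * m)%N.
  rewrite cardsU1; apply: leq_add; first exact: leq_b1.
  by apply: leq_trans (leq_imset_card _ _) _; rewrite card_ord.
have S0 : 0 \in S by rewrite finset.setU11.
have powS j : (j < k * m)%N -> 3 ^+ j \in S.
  move=> jk; rewrite finset.inE; apply/orP; right.
  by apply/imsetP; exists (Ordinal jk).
have km0 : (0 < k * m)%N by case: (k * m)%N pkm => //; rewrite leqNgt p1.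
have adjoin (T : {set 'Z_p}) a : {subset S <= T} ->
    exists U c, [/\ average_extension T U c,
      (2 * c <= m + 2 * L * 3 ^ k + 2 * k * 3 ^ k + 2 * k * k.+2)%N & a \in U].
  (* Multiplying [a] beforehand by the divisor makes the quotient reached equal to [a]; the
     representative [N] is below [p], hence below [3 ^ (k * m)]. *)
  move=> sST; pose N := nat_of_ord (a * 3 ^+ (L + k.+1 + k)).
  have [|i im||//|U [c [eU c2 xU]]] := @average_extension_quotient 'Z_p k m L T N u3.
  - exact: sST.
  - apply/sST/powS; rewrite ltn_mul2l im andbT.
    by move: km0; rewrite muln_gt0 => /andP[].
  - by apply: leq_trans pkm; rewrite -[X in (_ < X)%N](Zp_cast p1) ltn_ord.
  by exists U, c; split=> //; move: xU; rewrite natr_Zp mulrK ?unitrX.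
have [T [c [eT c2 mT]]] := adjoin S (-1) (fun x => id).
have sST := average_extension_sub _ _ _ _ eT.
have [U [d [eU d2 pU]]] := adjoin T (3 ^+ (k * m)) sST.
have eSU := average_extension_trans _ _ _ _ _ _ eT eU.
have sU := average_extension_sub _ _ _ _ eSU.
have [_ cardU avU] := eSU.
have one0 : (1 : 'Z_p) != 0 by exact: oner_neq0.
exists [set x + y | x in U, y in U]%SET; split.
- have A0 : 0 + 0 \in [set x + y | x in U, y in U]%SET by apply: imset2_f; exact: sU.
  have A1 : 0 + 1 \in [set x + y | x in U, y in U]%SET.
    by apply: imset2_f; [exact: sU | apply: sU; rewrite -(expr0 3) powS].
  rewrite !add0r in A0 A1; by apply/card_gt1P; exists 0, 1.
- apply: no_unique_sum_sumset => [x|x|x xU].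
  + by rewrite -mulr_natr => /(canRL (mulrK u2)); rewrite mul0r.
  + by rewrite -mulr_natr => /(canRL (mulrK u3)); rewrite mul0r.
  have [xS|xS] := boolP (x \in S); last exact: avU.
  (* Adjoined elements have averages by construction; only [0] and the initial powers remain. *)
  move: xS; rewrite finset.inE => /orP[|/imsetP[j _ ->]].
    rewrite finset.inE => /eqP->; exists 0, 1, (-1); split.
    * exact: sU.
    * by apply: sU; rewrite -(expr0 3) powS.
    * exact: average_extension_sub _ _ _ _ eU _ mT.
    * by rewrite mul0rn add0r subrr.
    * by rewrite (negPf one0) andbF.
  (* For the last power, [j.+1 = k * m] and the third summand is the adjoined residue. The average
     is nontrivial because a power of [3] is a unit, hence not [0]. *)
  exists 0, 0, (3 ^+ j.+1); split; [exact: sU|exact: sU| | |].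
  * have [->//|jkm] := eqVneq (nat_of_ord j).+1 (k * m)%N.
    by apply/sU/powS; rewrite ltn_neqAle jkm ltn_ord.
  * by rewrite !add0r exprS mulr_natl.
  * by rewrite eq_sym; case: eqVneq (unitrX j u3) => // ->; rewrite unitr0.
- apply: leq_trans (card_sumset U) _; rewrite /=.
  have : (#|U| <= 1 + k * m + (m + 2 * L * 3 ^ k + 2 * k * 3 ^ k + 2 * k * k.+2))%N.
    apply: leq_trans cardU _; apply: leq_add => //.
    move: c2 d2; set X := (_ + _ + _ + _)%N; lia.
  by move=> cU; apply: leq_mul.
Qed.

(** * Size estimates and choice of the parameters *)

(** From [t] to [t + 1] the left side grows by the factor [((t + 2) / t) ^ 2], less than [3]. The
    number [84] is [12 * 7]: the cost [7 * (k + 1) * 3 ^ k] is to be at most [y / (12 * k)]. *)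
Lemma quartic_le_exp3 (R : realType) k : (24 <= k)%N ->
  (84 * k%:R * (k%:R + 1)) ^+ 2 <= 3 ^+ k :> R.
Proof.
move=> /subnK <-; elim: (k - 24)%N => [|j IHj].
  have -> : (3 : R) ^+ (0 + 24) = (3 ^+ 6) ^+ 4 by rewrite -exprM.
  have -> : (3 : R) ^+ 6 = 729 by ring.
  have -> : ((0 + 24)%N%:R : R) = 24 by [].
  lra.
rewrite addSn [3 ^+ _.+1]exprS; set t := (j + 24)%N in IHj *.
apply: le_trans (_ : 3 * (84 * t%:R * (t%:R + 1)) ^+ 2 <= _); last by rewrite ler_pM2l.
have t24 : 24 <= t%:R :> R by rewrite ler_nat leq_addl.
rewrite -[t.+1%:R]natr1; move: (t%:R : R) t24 => z z24.
have -> : (84 * (z + 1) * (z + 1 + 1)) ^+ 2 = (84 * (z + 1)) ^+ 2 * (z + 2) ^+ 2 by ring.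
have -> : 3 * (84 * z * (z + 1)) ^+ 2 = (84 * (z + 1)) ^+ 2 * (3 * z ^+ 2) by ring.
by apply: ler_wpM2l; [exact: sqr_ge0 | nra].
Qed.

(** These are the costs other than [k * m] and [m] when [L = 2 * k + 2]; the summand [k + 3] absorbs
    the additive ones and the rounding of [m]. *)
Lemma cost_le (k : nat) : (24 <= k)%N ->
  (2 * (2 * k + 2) * 3 ^ k + 2 * k * 3 ^ k + 2 * k * k.+2 + k + 3
   <= 7 * k.+1 * 3 ^ k)%N.
Proof.
move=> k24; have : (2 * k + 3 <= 3 ^ k)%N.
  by elim: k k24 => // k IHk; rewrite leq_eqVlt => /orP[/eqP <-//|/IHk]; rewrite expnS; lia.
by set t := (3 ^ k)%N; nia.
Qed.

(** Here [y] stands for [log_3 p]. The last cost is at most [y / (12 * k)], so [s + 1 <= y * q] with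
    [q ^ 2 = 1 + 13 / (6 * k) + O(1 / k ^ 2)], and [13 / 6 < 8 / 3] leaves room. *)
Lemma square_cost_le (R : realType) (y s : R) (k : nat) : (24 <= k)%N ->
  0 < y -> 0 <= s -> 3 ^+ (3 * k) <= y ^+ 2 ->
  s + 1 <= y + y / k%:R + 7 * (k%:R + 1) * 3 ^+ k ->
  s * (s + 1) <= y ^+ 2 * (1 + 8 / (3 * k%:R + 5)).
Proof.
move=> k24 y0 s0 ky sy.
have kR : 24 <= k%:R :> R by rewrite ler_nat.
have k0 : 0 < k%:R :> R by lra.
have small : 12 * k%:R * (7 * (k%:R + 1) * 3 ^+ k) <= y.
  rewrite -(@ler_pXn2r _ 2) ?nnegrE ?(ltW y0) //.
  apply: le_trans ky.
  have -> : 12 * k%:R * (7 * (k%:R + 1) * 3 ^+ k) =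
    (84 * k%:R * (k%:R + 1)) * 3 ^+ k :> R by ring.
  rewrite exprMn -[(3 * k)%N]/(k + (k + (k + 0)))%N addn0 !exprD expr2 -expr2.
  by rewrite ler_pM2r ?quartic_le_exp3 // mulr_gt0 ?exprn_gt0.
pose q : R := 1 + 13 / (12 * k%:R).
have sq : s + 1 <= y * q.
  apply: le_trans sy _.
  have : 7 * (k%:R + 1) * 3 ^+ k <= y / (12 * k%:R).
    by rewrite ler_pdivlMr ?mulr_gt0 // mulrC.
  have -> : y * q = y + y / k%:R + y / (12 * k%:R) by rewrite /q; field; lra.
  lra.
apply: le_trans (_ : (y * q) * (y * q) <= _).
  by apply: ler_pM => //; lra.
rewrite -expr2 exprMn ler_pM2l ?exprn_gt0 //.
rewrite -subr_ge0.
have -> : 1 + 8 / (3 * k%:R + 5) - q ^+ 2 =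
   (216 * k%:R ^+ 2 - 2067 * k%:R - 845) / (144 * k%:R ^+ 2 * (3 * k%:R + 5)).
  rewrite /q; field; lra.
apply: divr_ge0; nra.
Qed.

Lemma exp3_bracket (R : realType) (z : R) n : 3 ^+ (3 * n) <= z ->
  exists k, [/\ (n <= k)%N, 3 ^+ (3 * k) <= z & z < 3 ^+ (3 * k.+1)].
Proof.
move=> nz.
have exK : exists K, z < 3 ^+ (3 * K).
  exists (Num.truncn z).+1; apply: lt_le_trans (truncnS_gt z) _.
  rewrite -natrX ler_nat; apply: ltnW.
  apply: (leq_ltn_trans _ (ltn_expl _ (isT : 1 < 3)%N)).
  by exact: leq_pmull.
case: (ex_minnP exK) => K zK minK.
have nK : (n < K)%N.
  rewrite ltnNge; apply/negP => Kn.
  have : 3 ^+ (3 * K) <= 3 ^+ (3 * n) :> R.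
    by rewrite ler_eXn2l ?ltr1n // leq_mul2l Kn orbT.
  by move=> /le_trans /(_ nz); rewrite leNgt zK.
case: K zK minK nK => // k zk mink nk; exists k; split=> //.
by rewrite leNgt; apply/negP => /mink; rewrite ltnn.
Qed.

(** The slack in [square_cost_le] absorbs all error terms, so no [eps] appears and one threshold
    serves every [eps]. *)
Lemma exists_small_no_unique_sum (R : realType) : exists P, (5 <= P)%N /\
  forall p, prime p -> (P <= p)%N -> 1 < ln (p%:R : R) /\
    exists A : {set 'Z_p}, [/\ (2 <= #|A|)%N, no_unique_sum A &
      #|A|%:R <= (ln p%:R) ^+ 2 / (2 * (ln 3) ^+ 2)
         + 2 / ln 3 * ((ln p%:R) ^+ 2 / ln (ln p%:R)) :> R].
Proof.
pose l : R := ln 3; have l0 : 0 < l by rewrite ln_gt0 // ltr1n.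
(* This [M] gives [ln p >= H * (l + 1)] with [H = 3 ^+ (3 * 24)], hence [x > 1] and [y >= H], so
   that the bracketing of [y ^+ 2] yields [k >= 24]. *)
have [M leM] : exists M, expR (3 ^+ (3 * 24) * (l + 1)) <= M%:R.
  by eexists; exact: ltW (truncnS_gt _).
exists (maxn 5 M); split; first exact: leq_maxl.
move=> p pp; rewrite geq_max => /andP[p5 Mp].
have p0 : 0 < p%:R :> R by rewrite ltr0n prime_gt0.
pose x : R := ln p%:R; pose y := x / l.
have big3 : 2 <= 3 ^+ (3 * 24) :> R.
  by apply: le_trans (_ : 3 ^+ 1 <= _); rewrite ?ler_nat // ler_eXn2l ?ltr1n.
have xM : 3 ^+ (3 * 24) * (l + 1) <= x.
  rewrite -ler_expR lnK ?posrE //; apply: le_trans leM _.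
  by rewrite ler_nat.
set H : R := 3 ^+ _ in big3 xM leM.
have x1 : 1 < x by nra.
have yH : H <= y by rewrite ler_pdivlMr //; nra.
have y0 : 0 < y by lra.
have Hy2 : H <= y ^+ 2 by nra.
have [k [k24 ky yk]] := @exp3_bracket R _ _ Hy2.
clearbody H; clear Mp leM.
have k1 : (0 < k)%N by exact: leq_trans k24.
have kR : 24 <= k%:R :> R by rewrite ler_nat.
have k0 : 0 < k%:R :> R by lra.
have xE : x = y * l by rewrite /y divfK // gt_eqF.
split => //.
(* Now [3 ^ k <= y ^ (2/3)], which makes all costs but [k * m] and [m] negligible
   compared to [y / k]. *)
pose m := (Num.truncn (y / k%:R)).+1.
have mlt : y / k%:R < m%:R := truncnS_gt _.
have mle : m%:R <= y / k%:R + 1.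
  rewrite -natr1 lerD2r truncn_le; apply: divr_ge0; exact: ltW.
have ymk : y <= (k * m)%:R by rewrite natrM mulrC -ler_pdivrMr // ltW.
have pkm : (p <= 3 ^ (k * m))%N.
  rewrite -(ler_nat R) natrX -ler_ln ?posrE ?exprn_gt0 // lnXn // -/l -/x xE.
  by rewrite -mulr_natl ler_pM2r.
(* Indeed [m <= y] and [y ^+ 2 < 3 ^+ (3 * k.+1)], which is at most the square of
   [3 ^+ (2 * k + 2)]. *)
have mL : (m <= 3 ^ (2 * k + 2))%N.
  rewrite -(ler_nat R) natrX; apply: le_trans (_ : y <= _).
    apply: le_trans mle _; rewrite -lerBrDl.
    have -> : y - y / k%:R = y * (1 - k%:R^-1) by rewrite mulrBr mulr1.
    have : k%:R^-1 <= 2^-1 :> R by rewrite lef_pV2 ?posrE //; lra.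
    nra.
  rewrite -(@ler_pXn2r _ 2) ?nnegrE ?(ltW y0) ?exprn_ge0 // -exprM.
  by apply: le_trans (ltW yk) _; rewrite ler_eXn2l ?ltr1n //; clear; lia.
have [//|A [A2 nusA As]] := small_no_unique_sum p k m _ pp _ pkm mL.
  exact: leq_trans p5.
exists A; split=> //; rewrite -/l -/x.
move: As; set s := (_ + _ + _)%N => /= As.
have sy : s%:R + 1 <= y + y / k%:R + 7 * (k%:R + 1) * 3 ^+ k.
  have : (s + 1 + k + 1 <= k * m + m + 7 * (k + 1) * 3 ^ k)%N.
    by have := cost_le k k24; rewrite /s addn1; clear; lia.
  clearbody s; rewrite -(ler_nat R) !natrD !natrM natrX natrD.
  have : k%:R * m%:R <= y + k%:R.
    have -> : y + k%:R = k%:R * (y / k%:R + 1) by field; lra.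
    by rewrite ler_pM2l.
  lra.
have := @square_cost_le R y s%:R k k24 y0 (ler0n _ _) ky sy.
have {}As : 2 * #|A|%:R <= s%:R * (s%:R + 1) :> R.
  by rewrite natr1 -!natrM ler_nat.
move=> ss.
(* Since [x = y * l], the bracketing contributes [l * (3 * k + 3) / 2] and [ln l < l] the rest. This
   is the source of [3 * k + 5], and it turns [4 * y ^+ 2 / (3 * k + 5)] into the second term of the
   bound. *)
have lnx : ln x <= l * (3 * k%:R + 5) / 2.
  rewrite xE lnM ?posrE //.
  have : ln (y ^+ 2) <= ln (3 ^+ (3 * k.+1)) by rewrite ler_ln ?posrE ?exprn_gt0 ?ltW.
  rewrite !lnXn // -/l -(mulr_natr l) natrM -natr1 => lny.
  have := ln_sublinear l0; rewrite mulr2n in lny; lra.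
have lnx0 : 0 < ln x by rewrite ln_gt0.
move: (ln x) lnx lnx0 => w lnx lnx0.
have -> : x ^+ 2 / (2 * l ^+ 2) = y ^+ 2 / 2 by rewrite /y; field; lra.
have : 4 * y ^+ 2 / (3 * k%:R + 5) <= 2 / l * (x ^+ 2 / w).
  have -> : 2 / l * (x ^+ 2 / w) = 2 * y ^+ 2 * l / w.
    by rewrite xE; field; rewrite !gt_eqF.
  rewrite ler_pdivrMr; last lra.
  rewrite mulrAC ler_pdivlMr //.
  have : 0 <= y ^+ 2 by exact: sqr_ge0.
  nra.
have e : y ^+ 2 * (1 + 8 / (3 * k%:R + 5)) =
    y ^+ 2 + 2 * (4 * y ^+ 2 / (3 * k%:R + 5)).
  by field; lra.
rewrite e in ss; lra.
Qed.

(** * Limits along the primes *)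

Lemma cvg_within_prime0 (R : realType) (P : nat) (f delta : nat -> R) :
  (forall p, prime p -> (P <= p)%N -> delta p = f p) ->
  f p @[p --> \oo] --> (0 : R) ->
  delta p @[p --> within [set q : nat | prime q] \oo] --> (0 : R).
Proof.
move=> df f0; apply: (cvg_trans _ (cvg_within_filter [set q | prime q] f0)).
apply: near_eq_cvg; rewrite /within /prop_near1 /=.
by exists P => //= p Pp pp; rewrite df.
Qed.

Lemma cvg_div_ln_ln (R : realType) (c : R) :
  c / ln (ln (n%:R : R)) @[n --> \oo] --> (0 : R).
Proof.
rewrite -[X in _ --> X](mulr0 c); apply: cvgMr.
apply/cvgrPdist_lt => e e0.
pose N := (Num.truncn (expR (expR e^-1))).+1.
exists N => //= n Nn.
have lt1 : expR (expR e^-1) < n%:R.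
  by apply: lt_le_trans (truncnS_gt _) _; rewrite ler_nat.
have n0 : 0 < n%:R :> R by apply: lt_trans lt1; exact: expR_gt0.
have lt2 : expR e^-1 < ln n%:R by rewrite -ltr_expR lnK.
have ln0 : 0 < ln n%:R :> R by apply: lt_trans lt2; exact: expR_gt0.
have lt3 : e^-1 < ln (ln n%:R) by rewrite -ltr_expR lnK.
have ei : 0 < e^-1 by rewrite invr_gt0.
have lln0 := lt_trans ei lt3.
by rewrite sub0r normrN gtr0_norm ?invr_gt0 // -[e]invrK ltf_pV2.
Qed.

(** * Numerical bounds for logarithms *)

(** Because [3 > (6 / 5) ^ 6] and [ln (6 / 5) >= 1 / 6]. It makes [ln (ln p)] positive already at
    [p = 3]. *)
Lemma ln3_gt1 (R : realType) : 1 < ln (3 : R).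
Proof.
have pos : 0 < 5 / 6 :> R by lra.
have : ln (5 / 6 : R) <= - (1 / 6).
  by rewrite (_ : 5 / 6 = 1 + - (1 / 6)) ?le_ln1Dx //; lra.
have : ln (((5 / 6 : R)^-1) ^+ 6) < ln 3.
  rewrite ltr_ln ?posrE ?exprn_gt0 ?invr_gt0 // invfM invrK !exprMn.
  lra.
by rewrite lnXn ?invr_gt0 // lnV ?posrE //; lra.
Qed.

(** The mean value theorem for [ln (1 + s) - ln (1 - s) - 2 * P.[s]]: the sign of the derivative
    decides whether [2 * P] bounds the logarithm from below or above. *)
Lemma ln_ratio_MVT (R : realType) (P : {poly R}) (t : R) : 0 < t < 1 ->
  exists2 c, 0 < c < t & ln (1 + t) - ln (1 - t) - 2 * (P.[t] - P.[0]) =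
    2 * ((1 - c ^+ 2)^-1 - P^`().[c]) * t.
Proof.
move=> /andP[t0 t1].
pose f (s : R) := ln (1 + s) - ln (1 - s) - 2 * P.[s].
pose df (s : R) := 2 * ((1 - s ^+ 2)^-1 - P^`().[s]).
have fD (s : R) : -1 < s < 1 -> is_derive s 1 f (df s).
  move=> /andP[s1 s2].
  have d1 : is_derive s 1 (fun s : R => 1 + s) 1.
    have := is_deriveD (is_derive_cst (1 : R^o) (s : R^o) 1) (is_derive_id (s : R^o) 1).
    by rewrite add0r; apply.
  have d2 : is_derive s 1 (fun s : R => 1 - s) (-1).
    have := is_deriveB (is_derive_cst (1 : R^o) (s : R^o) 1) (is_derive_id (s : R^o) 1).
    by rewrite sub0r; apply.
  have l1 : is_derive s 1 (fun s : R => ln (1 + s)) ((1 + s)^-1 * 1).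
    by apply: is_derive1_comp d1; apply: is_derive1_ln; lra.
  have l2 : is_derive s 1 (fun s : R => ln (1 - s)) ((1 - s)^-1 * -1).
    by apply: is_derive1_comp d2; apply: is_derive1_ln; lra.
  have lP : is_derive s 1 (fun s : R => 2 * P.[s]) (2 * P^`().[s]).
    exact: is_deriveZ.
  apply: is_derive_eq (is_deriveB (is_deriveB l1 l2) lP) _.
  by rewrite /df; field; rewrite !lt0r_neq0; nra.
have [s||c cI e] := @MVT R f df 0 t t0.
- by rewrite in_itv /= => /andP[? ?]; apply: fD; lra.
- apply: continuous_in_subspaceT => s; rewrite inE /= in_itv /= => /andP[s0 s1].
  apply: differentiable_continuous; apply/derivable1_diffP.
  by have [] := fD s; first by lra.
exists c; first by move: cI; rewrite in_itv.
move: e; rewrite /f /df !subr0 addr0 ln1 subrr sub0r => <-; ring.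
Qed.

(** Taylor polynomial of [artanh], where [2 * artanh t = ln (1 + t) - ln (1 - t)]. *)
Definition artanh_poly {R : realType} n : {poly R} :=
  \sum_(j < n) (2 * j + 1)%:R^-1 *: 'X^(2 * j + 1).

(** The derivative is a finite geometric sum in [c ^+ 2]. *)
Lemma deriv_artanh_poly (R : realType) n (c : R) : c ^+ 2 < 1 ->
  (artanh_poly n)^`().[c] = (1 - c ^+ 2)^-1 - c ^+ (2 * n) / (1 - c ^+ 2).
Proof.
move=> c1; apply: (@mulIf _ (1 - c ^+ 2)); first by rewrite gt_eqF // subr_gt0.
rewrite mulrBl divfK ?mulVf ?gt_eqF ?subr_gt0 //.
elim: n => [|n IHn].
  by rewrite /artanh_poly big_ord0 derivC horner0 mul0r muln0 expr0 subrr.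
rewrite /artanh_poly big_ord_recr /= derivD hornerD mulrDl IHn.
rewrite derivZ derivXn addn1 /= hornerZ hornerMn hornerXn.
rewrite -[c ^+ _ *+ _]mulr_natl mulKf ?pnatr_eq0 //.
rewrite mulnS exprD; ring.
Qed.

Lemma horner_artanh_poly (R : realType) n (t : R) :
  (artanh_poly n).[t] = \sum_(j < n) t ^+ (2 * j + 1) / (2 * j + 1)%:R.
Proof.
rewrite horner_sum; apply: eq_bigr => j _.
by rewrite hornerZ hornerXn mulrC.
Qed.

Lemma artanh_bounds (R : realType) n (t : R) : 0 < t < 1 ->
  2 * (artanh_poly n).[t] <= ln (1 + t) - ln (1 - t)
    <= 2 * ((artanh_poly n).[t] + t ^+ (2 * n + 1) / (2 * n + 1)%:R / (1 - t ^+ 2)).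
Proof.
move=> t01; have /andP[t0 t1] := t01.
have A0 : (artanh_poly n).[0 : R] = 0.
  by rewrite horner_artanh_poly big1 // => j _; rewrite addn1 expr0n mul0r.
have small (c : R) : 0 < c -> c < t -> c ^+ 2 < 1 /\ c ^+ 2 <= t ^+ 2.
  by move=> c0 ct; split; nra.
apply/andP; split.
  have [c /andP[c0 ct]] := ln_ratio_MVT R (artanh_poly n) t t01.
  have [c2 _] := small c c0 ct.
  rewrite deriv_artanh_poly // opprB addrCA subrr addr0 A0 subr0 => e.
  rewrite -subr_ge0 e.
  by rewrite !mulr_ge0 ?invr_ge0 ?subr_ge0 ?exprn_ge0 // ltW.
(* For the upper bound, the Taylor remainder [c ^+ (2 * n) / (1 - c ^+ 2)] of the derivative is
   majorized by [C * c ^+ (2 * n)], whose primitive is added to the polynomial. *)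
pose C : R := (1 - t ^+ 2)^-1.
pose P := artanh_poly n + (C / (2 * n + 1)%:R) *: 'X^(2 * n + 1).
have [c /andP[c0 ct]] := ln_ratio_MVT R P t t01.
have [c2 cn] := small c c0 ct.
have -> : P^`().[c] = (1 - c ^+ 2)^-1 - c ^+ (2 * n) / (1 - c ^+ 2) + C * c ^+ (2 * n).
  rewrite /P derivD derivZ derivXn addn1 /= hornerD hornerZ hornerMn hornerXn.
  by rewrite deriv_artanh_poly // -[c ^+ _ *+ _]mulr_natl mulrA divfK ?pnatr_eq0.
have -> : P.[t] - P.[0] = (artanh_poly n).[t]
    + t ^+ (2 * n + 1) / (2 * n + 1)%:R / (1 - t ^+ 2).
  rewrite /P !hornerD !hornerZ !hornerXn A0 expr0n addn1 /= mulr0 addr0 subr0.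
  by congr (_ + _); rewrite mulrC -mulrA [C / _]mulrC.
move=> e; rewrite -subr_le0 e.
have -> : (1 - c ^+ 2)^-1
    - ((1 - c ^+ 2)^-1 - c ^+ (2 * n) / (1 - c ^+ 2) + C * c ^+ (2 * n))
  = c ^+ (2 * n) * ((1 - c ^+ 2)^-1 - C) by ring.
have le0 : (1 - c ^+ 2)^-1 <= C by rewrite lef_pV2 ?posrE; nra.
have : 0 <= c ^+ (2 * n) by rewrite exprn_ge0 // ltW.
move: (c ^+ _) => z z0.
by rewrite pmulr_lle0 // pmulr_rle0 // mulr_ge0_le0 // subr_le0.
Qed.

Lemma artanh_poly10 (R : realType) (t : R) : (artanh_poly 10).[t] =
  t * (1 + t ^+ 2 * (1 / 3 + t ^+ 2 * (1 / 5 + t ^+ 2 * (1 / 7 + t ^+ 2 *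
    (1 / 9 + t ^+ 2 * (1 / 11 + t ^+ 2 * (1 / 13 + t ^+ 2 * (1 / 15 + t ^+ 2 *
    (1 / 17 + t ^+ 2 / 19))))))))).
Proof.
by rewrite horner_artanh_poly !big_ord_recr big_ord0 /=; field.
Qed.

(* [a (1 / 7) = ln (4 / 3)] and [a (1 / 17) = ln (9 / 8)]. *)
Lemma ln2_ln3_artanh (R : realType) :
  let a (t : R) := ln (1 + t) - ln (1 - t) in
  ln 2 = 2 * a (1 / 7) + a (1 / 17) /\ ln 3 = 3 * a (1 / 7) + 2 * a (1 / 17).
Proof.
move=> a.
have ln_ratio (m n k : nat) : (0 < m)%N -> (0 < n)%N -> (0 < k)%N ->
    ln (m%:R / k%:R : R) - ln (n%:R / k%:R) = ln m%:R - ln n%:R.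
  move=> m0 n0 k0; rewrite !ln_div ?posrE ?ltr0n //; ring.
have l6 : ln 6 = ln 2 + ln 3 :> R by rewrite -lnM ?posrE //; congr ln; ring.
have l8 : ln 8 = 3 * ln 2 :> R.
  by rewrite (_ : 8 = 2 ^+ 3) ?lnXn // ?mulr_natl //; ring.
have l16 : ln 16 = 4 * ln 2 :> R.
  by rewrite (_ : 16 = 2 ^+ 4) ?lnXn // ?mulr_natl //; ring.
have l18 : ln 18 = ln 2 + 2 * ln 3 :> R.
  by rewrite (_ : 18 = 2 * 3 ^+ 2) ?lnM ?posrE ?lnXn ?exprn_gt0 // ?mulr_natl //; ring.
have -> : a (1 / 7) = 2 * ln 2 - ln 3.
  rewrite /a (_ : 1 + 1 / 7 = 8 / 7); last by field.
  rewrite (_ : 1 - 1 / 7 = 6 / 7); last by field.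
  by rewrite (ln_ratio 8 6 7)%N // l6 l8; ring.
have -> : a (1 / 17) = 2 * ln 3 - 3 * ln 2.
  rewrite /a (_ : 1 + 1 / 17 = 18 / 17); last by field.
  rewrite (_ : 1 - 1 / 17 = 16 / 17); last by field.
  by rewrite (ln_ratio 18 16 17)%N // l16 l18; ring.
by split; ring.
Qed.

(** Ten Taylor terms suffice: at [1 / 7] and [1 / 17] they leave gaps below [10 ^ (-18)]. As
    [2 - 3 * r > 0 > 1 - 2 * r], a lower bound for one logarithm is paired with an upper bound for
    the other. *)
Lemma ln2_ln3_bounds (R : realType) (r : R) :
  r = decimal R [:: 6; 3; 0; 9; 2; 9; 7; 5; 3; 5; 7; 1; 4; 5; 7; 4; 3; 6; 8]%N ->
  r * ln 3 <= ln 2 <= (r + 1 / 10 ^+ 15) * ln 3.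
Proof.
move=> rE.
have [l2E l3E] := ln2_ln3_artanh R.
have ineq7 : 0 < (1 / 7 : R) < 1 by lra.
have ineq17 : 0 < (1 / 17 : R) < 1 by lra.
have := artanh_bounds _ 10 _ ineq17.
have := artanh_bounds _ 10 _ ineq7.
rewrite l2E l3E !artanh_poly10 (_ : (2 * 10 + 1)%N = 21%N) //.
have -> : (1 - (1 / 7 : R) ^+ 2)^-1 = 49 / 48 by field; lra.
have -> : (1 - (1 / 17 : R) ^+ 2)^-1 = 289 / 288 by field; lra.
move: (ln (1 + 1 / 7) - _) (ln (1 + 1 / 17) - _) => a b.
rewrite rE /decimal !big_ord_recr big_ord0 /=; clear.
move=> /andP[lo7 hi7] /andP[lo17 hi17]; apply/andP; split.
  lra.
lra.
Qed.

(** The constant is half the square of [ln 2 / ln 3]. It exceeds [c] by less than [10 ^ (-17)],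
    which is why the lower approximation [r] carries nineteen digits, while [10 ^ (-15)] is precise
    enough above. *)
Lemma leading_constant_bounds (R : realType) (c : R) :
  c = decimal R [:: 1; 9; 9; 0; 3; 6; 1; 7; 6; 9; 7; 0; 8; 7; 0]%N ->
  c <= 1 / (2 * (log2 (3 : R)) ^+ 2) < c + 1 / 10 ^+ 15.
Proof.
move=> cE.
pose r := decimal R [:: 6; 3; 0; 9; 2; 9; 7; 5; 3; 5; 7; 1; 4; 5; 7; 4; 3; 6; 8]%N.
have l2 : 0 < ln 2 :> R by rewrite ln_gt0 // ltr1n.
have l3 : 0 < ln 3 :> R by rewrite ln_gt0 // ltr1n.
have := ln2_ln3_bounds R r erefl.
move=> /andP[rl lr].
have : ln 2 / ln 3 <= r + 1 / 10 ^+ 15 by rewrite ler_pdivrMr.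
have : r <= ln 2 / ln 3 by rewrite ler_pdivlMr.
clear rl lr.
have -> : 1 / (2 * log2 (3 : R) ^+ 2) = (ln 2 / ln 3) ^+ 2 / 2.
  by rewrite /log2; field; rewrite !gt_eqF.
move: (ln 2 / ln 3) => q rq qr.
have r0 : 0 <= r.
  by apply: sumr_ge0 => i _; rewrite mulr_ge0 ?invr_ge0 ?exprn_ge0.
have q0 : 0 <= q by exact: le_trans r0 rq.
have : q ^+ 2 <= (r + 1 / 10 ^+ 15) ^+ 2 by rewrite !expr2 ler_pM.
have : r ^+ 2 <= q ^+ 2 by rewrite !expr2 ler_pM.
(* Numerals in [R] are read in unary, hence the groups of four digits. *)
have -> : r = 6309 / 10 ^+ 4 + 2975 / 10 ^+ 8 + 3571 / 10 ^+ 12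
               + 4574 / 10 ^+ 16 + 3680 / 10 ^+ 20.
  by rewrite /r /decimal !big_ord_recr big_ord0 /=; clear; lra.
have -> : c = 1990 / 10 ^+ 4 + 3617 / 10 ^+ 8 + 6970 / 10 ^+ 12 + 8700 / 10 ^+ 16.
  by rewrite cE /decimal !big_ord_recr big_ord0 /=; clear; lra.
move: (q ^+ 2) => q2; clear => lo hi; apply/andP; split; lra.
Qed.

(** * Deduction of the asymptotic bounds *)

Theorem theorem1p3 (R : realType) :
  [/\ forall eps : R, 0 < eps ->
        exists peps : nat, (5 <= peps)%N /\
          forall p : nat, prime p -> (peps <= p)%N ->
            exists A : {set 'Z_p},
              [/\ (2 <= #|A|)%N, no_unique_sum A &
                #|A|%:R <= (ln p%:R) ^+ 2 / (2 * (ln 3) ^+ 2)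
                           + (2 / ln 3 + eps)
                             * ((ln p%:R) ^+ 2 / ln (ln p%:R))],
      exists delta : nat -> R,
        delta p @[p --> within [set q : nat | prime q] \oo] --> (0 : R) /\
        forall p : nat, prime p -> (3 <= p)%N ->
          (min_no_unique_sum p)%:R
            <= (ln p%:R) ^+ 2 / (2 * (ln 3) ^+ 2)
               + (2 / ln 3 + delta p) * ((ln p%:R) ^+ 2 / ln (ln p%:R)),
      exists delta : nat -> R,
        delta p @[p --> within [set q : nat | prime q] \oo] --> (0 : R) /\
        forall p : nat, prime p -> (3 <= p)%N ->
          (min_no_unique_sum p)%:R
            <= (1 / (2 * (log2 (3 : R)) ^+ 2) + delta p)
               * (log2 (p%:R : R)) ^+ 2 &
      let c := decimal R [:: 1; 9; 9; 0; 3; 6; 1; 7; 6; 9; 7; 0; 8; 7; 0]%N in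
      c <= 1 / (2 * (log2 (3 : R)) ^+ 2) < c + 1 / 10 ^+ 15].
Proof.
have [P [P5 HP]] := exists_small_no_unique_sum R.
have l3 : 0 < ln 3 :> R by rewrite ln_gt0 // ltr1n.
have l2 : 0 < ln 2 :> R by rewrite ln_gt0 // ltr1n.
have lnp p : (3 <= p)%N -> 1 < ln p%:R :> R.
  move=> p3; apply: lt_le_trans (_ : ln 3 <= _); last first.
    by rewrite ler_ln ?posrE ?ler_nat ?ltr0n //; exact: ltn_trans p3.
  exact: ln3_gt1.
have minle p : prime p -> (P <= p)%N -> (min_no_unique_sum p)%:R <=
    (ln p%:R) ^+ 2 / (2 * (ln 3) ^+ 2)
     + 2 / ln 3 * ((ln p%:R) ^+ 2 / ln (ln p%:R)) :> R.
  move=> pp Pp; have [_ [A [A2 nusA Ale]]] := HP p pp Pp.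
  apply: le_trans Ale; rewrite ler_nat.
  have p3 : (3 <= p)%N by exact: leq_trans (leq_trans _ P5) Pp.
  by have [_] := min_no_unique_sumP pp p3; apply.
split; last exact: leading_constant_bounds.
- move=> eps eps0; exists P; split=> // p pp Pp.
  have [x1 [A [A2 nusA Ale]]] := HP p pp Pp; exists A; split=> //.
  apply: le_trans Ale _; rewrite lerD2l; apply: ler_wpM2r.
    by apply: divr_ge0; [exact: sqr_ge0 | apply: ltW; rewrite ln_gt0].
  by rewrite lerDl ltW.
(* Below [P] the value of [delta] makes its own term equal to the minimum; from [P] on it is [0]. *)
- exists (fun p => if (P <= p)%N then 0 else
    (min_no_unique_sum p)%:R / ((ln p%:R) ^+ 2 / ln (ln p%:R))); split.
    apply: (@cvg_within_prime0 R P (fun=> 0)); last exact: cvg_cst.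
    by move=> p _ ->.
  move=> p pp p3; case: ifP => Pp; first by rewrite addr0; exact: minle.
  have x1 := lnp p p3; have lx0 : 0 < ln (ln p%:R) :> R by rewrite ln_gt0.
  have q0 : 0 < (ln p%:R) ^+ 2 / ln (ln p%:R) :> R.
    by rewrite divr_gt0 // exprn_gt0 //; apply: lt_trans x1.
  rewrite [X in _ <= _ + X]mulrDl divfK ?gt_eqF // addrA lerDr addr_ge0 //.
    by rewrite divr_ge0 ?sqr_ge0 // mulr_ge0 // sqr_ge0.
  by rewrite mulr_ge0 // ?ltW // divr_gt0.
(* From [P] on, [delta] is the second term of the bound divided by [(log2 p) ^+ 2], so the two
   bounds coincide; below [P] it is again the trivial choice. *)
- exists (fun p => if (P <= p)%N then 2 / ln 3 * ln 2 ^+ 2 / ln (ln p%:R)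
    else (min_no_unique_sum p)%:R / (log2 (p%:R : R)) ^+ 2); split.
    apply: (@cvg_within_prime0 R P _ _ _ (cvg_div_ln_ln R (2 / ln 3 * ln 2 ^+ 2))).
    by move=> p _ ->.
  move=> p pp p3; have x1 := lnp p p3; rewrite /log2; case: ifP => Pp.
    apply: le_trans (minle p pp Pp) _.
    have lx0 : 0 < ln (ln p%:R) :> R by rewrite ln_gt0.
    move: (ln (ln p%:R)) lx0 => w w0; rewrite le_eqVlt; apply/orP; left; apply/eqP.
    by field; rewrite !gt_eqF.
  have q0 : 0 < (ln p%:R / ln 2) ^+ 2 :> R.
    by rewrite exprn_gt0 // divr_gt0 //; apply: lt_trans x1.
  rewrite mulrDl divfK ?gt_eqF // lerDr mulr_ge0 ?sqr_ge0 // divr_ge0 //.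
  by rewrite mulr_ge0 ?sqr_ge0.
Qed.
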